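(* Let $H$ be a complex Hilbert space, let $A\in B(H)$ be a non-zero positive semidefinite operator with closed range $R(A)$, let $T\in B_A(H)$ be $A$-normal, and let $f$ be a continuous (complex-valued) function on $\sigma_A(T)$. Then $$f(\sigma_A(T))=\sigma_A\big((A^{1/2})^{\dagger}f(T_a^{*})A^{1/2}\big).$$
   Context: $B(H)$ is the algebra of bounded linear operators on $H$; $R(\cdot)$ denotes range; $S^{\dagger}$ denotes the Moore–Penrose inverse of $S$. $\|x\|_A=\langle Ax,x\rangle^{1/2}$. $B_A(H)=\{T\in B(H): R(T^*A)\subset R(A)\}$. For $T\in B_A(H)$, $T^{\sharp}\in B(H)$ is the unique operator with $T^*A=AT^{\sharp}$ and $R(T^{\sharp})\subset\overline{R(A)}$. An operator $T\in B_A(H)$ is $A$-normal if $\|Tx\|_A=\|T^{\sharp}x\|_A$ for all $x\in H$. $B_{A^{1/2}}(H)=\{T\in B(H): R(T^*A^{1/2})\subset R(A^{1/2})\}$; equivalently, there is $d>0$ with $\|Tx\|_A\le d\|x\|_A$ for all $x\in H$. One has $B_A(H)\subset B_{A^{1/2}}(H)$. A non-zero $T\in B_{A^{1/2}}(H)$ is $A$-invertible in $B_{A^{1/2}}(H)$ if there is a non-zero $S\in B_{A^{1/2}}(H)$ with $ATS=AST=A$. For $T\in B_{A^{1/2}}(H)$, $\rho_A(T)=\{\lambda\in\mathbb C:\lambda-T\text{ is }A\text{-invertible in }B_{A^{1/2}}(H)\}$ and $\sigma_A(T)=\mathbb C\setminus\rho_A(T)$. For $T\in B_{A^{1/2}}(H)$,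 $T_a:\overline{R(A)}\to\overline{R(A)}$ is the bounded operator $T_a x=(A^{1/2})^{\dagger}T^*A^{1/2}x$, and $T_a^*$ is its adjoint on the Hilbert space $\overline{R(A)}$. In the setting of the claim, $T_a^*$ is normal with ordinary spectrum $\sigma(T_a^* )=\sigma_A(T)$, and $f(T_a^* )$ is the operator on $\overline{R(A)}=R(A)$ given by the continuous functional calculus; $(A^{1/2})^{\dagger}f(T_a^* )A^{1/2}$ is regarded as an operator on $H$ (it belongs to $B_{A^{1/2}}(H)$). *)

(* Defs.v *)
From mathcomp Require Import all_boot all_order all_algebra.
From mathcomp Require Import sesquilinear complex.
From mathcomp Require Import all_classical all_reals all_analysis.

Set Implicit Arguments.
Unset Strict Implicit.
Unset Printing Implicit Defensive.

Import Order.TTheory GRing.Theory Num.Theory Num.Def.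
Import numFieldNormedType.Exports.

Local Open Scope classical_set_scope.
Local Open Scope ring_scope.

(* The field R[i].  Naming it as a numClosedFieldType lets the topology that
   MathComp-Analysis puts on every numFieldType be inferred for it. *)
Definition complexes (R : realType) : numClosedFieldType := R[i].

(* H with dot is a Hilbert space when `|x| ^+ 2 = dot x x for every x; dot is
   linear in its first argument.  A closed subspace V of H is viewed as a
   Hilbert space in its own right; an operator on V is then a function H -> H
   of which only the restriction to V matters. *)
Section HilbertSpace.
Variables (R : realType) (H : completeNormedModType (complexes R)).
Variable dot : {dot H for conjC}.

Local Notation C := (complexes R).

Implicit Types (A sqrtA T S N : H -> H) (V : set H) (f g : C -> C).

Definition bounded_op T : Prop := linear T /\ continuous T.

Definition bounded_op_on V T : Prop :=
  [/\ forall x, V x -> V (T x),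
      forall (a : C) x y, V x -> V y -> T (a *: x + y) = a *: T x + T y &
      exists d : C, forall x, V x -> `|T x| <= d * `|x|].

(* By Riesz representation, the vector selected is the only one in the set
   when V is a closed subspace and T is bounded on V. *)
Definition adjoint_on V T (y : H) : H :=
  xget 0 [set z | V z /\ forall x, V x -> dot (T x) y = dot x z].

Definition adjoint T : H -> H := adjoint_on setT T.

Definition positive_op T : Prop := forall x, 0 <= dot (T x) x.

Definition positive_sqrt A S : Prop :=
  [/\ bounded_op S, positive_op S & S \o S = A].

(* S^dagger inverts the bijection N(S)^_|_ -> R(S) induced by S and vanishes
   on R(S)^_|_: for y in R(S) + R(S)^_|_, S^dagger y is the unique x in
   N(S)^_|_ such that y - S x is in R(S)^_|_.  Off this domain, the value is 0
   by convention. *)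
Definition mp_inverse S (y : H) : H :=
  xget 0 [set x | (forall z, S z = 0 -> dot x z = 0) /\
                  (forall z, dot (y - S x) (S z) = 0)].

Definition anorm A (x : H) : C := sqrtC (dot (A x) x).

Definition B_A A T : Prop :=
  bounded_op T /\ range (adjoint T \o A) `<=` range A.

(* T^sharp.  A is injective on the closure of R(A), hence the conditions
   A T^sharp = T^* A and R(T^sharp) `<=` closure R(A) define T^sharp pointwise. *)
Definition sharp A T (x : H) : H :=
  xget 0 [set z | A z = adjoint T (A x) /\ closure (range A) z].

Definition A_normal A T : Prop :=
  forall x, anorm A (T x) = anorm A (sharp A T x).

Definition B_sqrtA sqrtA T : Prop :=
  bounded_op T /\ range (adjoint T \o sqrtA) `<=` range sqrtA.

Definition A_invertible A sqrtA T : Prop :=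
  [/\ B_sqrtA sqrtA T, exists x, T x != 0 &
      exists S, [/\ B_sqrtA sqrtA S, exists x, S x != 0,
                    A \o T \o S = A & A \o S \o T = A]].

Definition A_resolvent A sqrtA T : set C :=
  [set l | A_invertible A sqrtA (fun x => l *: x - T x)].

Definition A_spectrum A sqrtA T : set C := ~` A_resolvent A sqrtA T.

Definition op_a sqrtA T (x : H) : H := mp_inverse sqrtA (adjoint T (sqrtA x)).

Definition invertible_on V T : Prop :=
  exists2 S, bounded_op_on V S & forall x, V x -> S (T x) = x /\ T (S x) = x.

Definition spectrum_on V N : set C :=
  [set l | ~ invertible_on V (fun x => l *: x - N x)].

Definition normal_on V N : Prop :=
  bounded_op_on V N /\
  forall x, V x -> N (adjoint_on V N x) = adjoint_on V N (N x).

(* Phi is the unital isometric *-homomorphism from the continuous functions on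
   the spectrum of N to the operators on V that maps the identity function to
   N.  Functions on the spectrum are represented by functions on C, of which
   only the restriction to the spectrum matters. *)
Record is_functional_calculus V N (Phi : (C -> C) -> H -> H) : Prop :=
  IsFunctionalCalculus {
  fc_bounded : forall f, {within spectrum_on V N, continuous f} ->
    bounded_op_on V (Phi f) ;
  fc_one : forall x, V x -> Phi (fun=> 1) x = x ;
  fc_id : forall x, V x -> Phi id x = N x ;
  fc_linear : forall (a : C) f g,
    {within spectrum_on V N, continuous f} ->
    {within spectrum_on V N, continuous g} ->
    forall x, V x -> Phi (fun z => a * f z + g z) x = a *: Phi f x + Phi g x ;
  fc_mul : forall f g,
    {within spectrum_on V N, continuous f} ->
    {within spectrum_on V N, continuous g} ->
    forall x, V x -> Phi (fun z => f z * g z) x = Phi f (Phi g x) ;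
  fc_conj : forall f, {within spectrum_on V N, continuous f} ->
    forall x, V x -> Phi (fun z => conjC (f z)) x = adjoint_on V (Phi f) x ;
  (* both norms have the same upper bounds, i.e. they are equal *)
  fc_isometry : forall f, {within spectrum_on V N, continuous f} ->
    forall M : C, 0 <= M ->
      ((forall x, V x -> `|Phi f x| <= M * `|x|) <->
       (forall z, spectrum_on V N z -> `|f z| <= M))
}.

(* cfc N f is the operator f(N), for N normal on V.  These conditions determine
   cfc N f on V when f is continuous on the spectrum of N. *)
Definition continuous_functional_calculus V
    (cfc : (H -> H) -> (C -> C) -> H -> H) : Prop :=
  forall N, normal_on V N -> is_functional_calculus V N (cfc N).

End HilbertSpace.

(* Main.v *)
From HB Require Import structures.
Require Import Defs.
From mathcomp Require Import all_boot all_order all_algebra.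
From mathcomp Require Import sesquilinear complex.
From mathcomp Require Import all_classical all_reals all_analysis.
From mathcomp Require Import ring lra.

(** Let S be the square root of A and V = R(A) = R(S), so that ker S is the
    orthogonal complement of V, and let L be the Moore-Penrose inverse of S: it
    is everywhere defined and symmetric, hence bounded (Hellinger-Toeplitz), and
    it inverts S on V.  An operator T is in B_{A^{1/2}}(H) exactly when it
    preserves ker S, and then T is A-invertible exactly when S T L is invertible
    on V.  Hence the A-spectrum of T is the spectrum on V of S T L, which equals
    the adjoint of T_a = L T^* S, while the A-spectrum of L F S is the spectrum of
    F on V.  A-normality says that S T L and its adjoint have the same norm at
    every vector of V, i.e. that S T L is normal on V, so the theorem reduces to
    the spectral mapping theorem for the continuous functional calculus. *)

Import Order.TTheory GRing.Theory Num.Theory Num.Def.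
Import numFieldNormedType.Exports.
Local Open Scope classical_set_scope.
Local Open Scope ring_scope.

Set Implicit Arguments.
Unset Strict Implicit.
Unset Printing Implicit Defensive.

(** * Real-valued norms, and limits with real radii *)

Section RealNorm.
Variable R : realType.
Local Notation C := (complexes R).

Definition ofR (r : R) : C := real_complex R r.

(* The order of R[i] is partial; rnorm brings norms back to the ordered field R. *)
Definition rnorm (V : normedZmodType C) (x : V) : R := complex.Re (`|x| : R[i]).

Lemma ge0_complexE (z : C) : 0 <= z -> z = ofR (complex.Re (z : R[i])).
Proof. by move=> z0; apply/esym/RRe_real/ger0_real. Qed.

Lemma ler_ofR (r s : R) : (ofR r <= ofR s) = (r <= s).
Proof. exact: lecR. Qed.

Lemma ltr_ofR (r s : R) : (ofR r < ofR s) = (r < s).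
Proof. exact: ltcR. Qed.

Lemma ofR_ge0 (r : R) : (0 <= ofR r) = (0 <= r).
Proof. exact: ler0c. Qed.

Lemma ofR_gt0 (r : R) : (0 < ofR r) = (0 < r).
Proof. exact: (ltcR 0 r). Qed.

Lemma ofRD (r s : R) : ofR (r + s) = ofR r + ofR s.
Proof. exact: rmorphD. Qed.

Lemma ofRM (r s : R) : ofR (r * s) = ofR r * ofR s.
Proof. exact: rmorphM. Qed.

Lemma ofR_inj : injective ofR. Proof. exact: complexI. Qed.

Lemma norm_rnorm (V : normedZmodType C) (x : V) : `|x| = ofR (rnorm x).
Proof. exact/ge0_complexE/normr_ge0. Qed.

Lemma rnorm_ge0 (V : normedZmodType C) (x : V) : 0 <= rnorm x.
Proof. by rewrite -ofR_ge0 -norm_rnorm. Qed.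

Lemma rnorm_eq0 (V : normedZmodType C) (x : V) : (rnorm x == 0) = (x == 0).
Proof. by rewrite -(normr_eq0 x) norm_rnorm -(inj_eq ofR_inj) [ofR 0]rmorph0. Qed.

Lemma rnorm_gt0 (V : normedZmodType C) (x : V) : (0 < rnorm x) = (x != 0).
Proof. by rewrite lt_def rnorm_eq0 rnorm_ge0 andbT. Qed.

Lemma rnormD (V : normedZmodType C) (x y : V) : rnorm (x + y) <= rnorm x + rnorm y.
Proof. by have := ler_normD x y; rewrite !norm_rnorm -ofRD ler_ofR. Qed.

Lemma rnormN (V : normedZmodType C) (x : V) : rnorm (- x) = rnorm x.
Proof. by rewrite /rnorm normrN. Qed.

Lemma rnormB (V : normedZmodType C) (x y : V) : rnorm (x - y) = rnorm (y - x).
Proof. by rewrite -rnormN opprB. Qed.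

Lemma rnorm_ofR (r : R) : 0 <= r -> rnorm (ofR r) = r.
Proof. by move=> r0; apply: ofR_inj; rewrite -norm_rnorm ger0_norm ?ofR_ge0. Qed.

Lemma rnormZ (V : normedModType C) (a : C) (x : V) :
  rnorm (a *: x) = rnorm a * rnorm x.
Proof. by have := normrZ a x; rewrite !norm_rnorm -ofRM => /ofR_inj. Qed.

Lemma cauchy_rnorm_cvg (V : completeNormedModType C) (u : V^nat) :
  (forall e : R, 0 < e -> exists N, forall n, (N <= n)%N -> rnorm (u n - u N) < e) ->
  exists l, forall e : R, 0 < e -> exists N, forall n, (N <= n)%N -> rnorm (u n - l) < e.
Proof.
move=> u_cauchy.
have /cauchy_cvg/cvg_ex[l /cvgrPdist_lt ul] : cauchy (u @ \oo).
  (* A positive element of [C] is real, so a complex radius can be traded for its real part. *)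
  apply: cauchy_exP => _/posnumP[e].
  have e0 : 0 < e%:num by [].
  have [N uN] : exists N, forall n, (N <= n)%N ->
      rnorm (u n - u N) < complex.Re (e%:num : R[i]).
    by apply: u_cauchy; rewrite -ltr_ofR -ge0_complexE.
  exists (u N), N => // n /= Nn.
  rewrite -ball_normE /ball_ /= distrC norm_rnorm (ge0_complexE (ltW e0)) ltr_ofR.
  exact: uN.
exists l => e e0; have [N _ uN] := ul (ofR e) (etrans (ofR_gt0 e) e0).
by exists N => n /uN /=; rewrite norm_rnorm ltr_ofR rnormB.
Qed.

Lemma closed_rnorm_cvg (V : normedModType C) (A : set V) (u : V^nat) l :
  closed A -> (forall n, A (u n)) ->
  (forall e : R, 0 < e -> exists N, forall n, (N <= n)%N -> rnorm (u n - l) < e) ->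
  A l.
Proof.
move=> Acl Au ul; apply: (@closed_cvg _ _ \oo _ u) => //; first exact: nearW.
apply/cvgrPdist_lt => e e0.
have [N uN] : exists N, forall n, (N <= n)%N ->
    rnorm (u n - l) < complex.Re (e : R[i]).
  by apply: ul; rewrite -ltr_ofR -ge0_complexE// ltW.
by exists N => // n /= /uN; rewrite -ltr_ofR -ge0_complexE ?ltW// -norm_rnorm distrC.
Qed.

End RealNorm.

(** * Inner products and orthogonal projection onto a closed subspace *)

Section HilbertSpace.
Variables (R : realType) (H : completeNormedModType (complexes R)).
Variable dot : {dot H for conjC}.
Hypothesis dot_norm : forall x : H, `|x| ^+ 2 = dot x x.
Local Notation C := (complexes R).
Implicit Types (x y z : H) (V : set H).

Lemma dotC x y : dot x y = (dot y x)^*.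
Proof. by rewrite hermC expr0 mul1r. Qed.

Lemma dotDl x y z : dot (x + y) z = dot x z + dot y z.
Proof. exact: linearDl. Qed.

Lemma dotDr x y z : dot x (y + z) = dot x y + dot x z.
Proof. exact: linearDr. Qed.

Lemma dotBl x y z : dot (x - y) z = dot x z - dot y z.
Proof. exact: linearBl. Qed.

Lemma dotBr x y z : dot x (y - z) = dot x y - dot x z.
Proof. exact: linearBr. Qed.

Lemma dotZl (a : C) x y : dot (a *: x) y = a * dot x y.
Proof. exact: linearZl_LR. Qed.

Lemma dotZr (a : C) x y : dot x (a *: y) = a^* * dot x y.
Proof. exact: linearZr_LR. Qed.

Lemma dot0l x : dot 0 x = 0.
Proof. exact: linear0l. Qed.

Lemma dot0r x : dot x 0 = 0.
Proof. exact: linear0r. Qed.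

Lemma dotxx x : dot x x = ofR (rnorm x ^+ 2).
Proof. by rewrite -dot_norm norm_rnorm expr2 -ofRM -expr2. Qed.

Lemma dot_eq0C x y : dot x y = 0 -> dot y x = 0.
Proof. by move=> xy0; rewrite dotC xy0 rmorph0. Qed.

Lemma dotxx_eq0 x : dot x x = 0 -> x = 0.
Proof. by move/eqP; rewrite dnorm_eq0 => /eqP. Qed.

(** Pythagoras. Nonnegativity of the left side yields Cauchy-Schwarz, and the decrease on the right
    side drives the minimality argument in [projection_ex]. *)
Lemma rnorm_proj x y : y != 0 ->
  rnorm (x - (dot x y / dot y y) *: y) ^+ 2
    = rnorm x ^+ 2 - rnorm (dot x y) ^+ 2 / rnorm y ^+ 2.
Proof.
move=> y0; apply: (@ofR_inj R).
have yy0 : dot y y != 0 by rewrite dnorm_eq0.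
have yyJ : (dot y y)^* = dot y y by rewrite -dotC.
have -> : ofR (rnorm x ^+ 2 - rnorm (dot x y) ^+ 2 / rnorm y ^+ 2)
    = dot x x - dot x y * (dot x y)^* / dot y y.
  rewrite /ofR rmorphB fmorph_div/= -!/(ofR _) -!dotxx -normCK norm_rnorm.
  by rewrite [in RHS]expr2 -ofRM -expr2.
rewrite -dotxx dotBl !dotBr !dotZl !dotZr (dotC y x) rmorphM fmorphV/= yyJ.
by field.
Qed.

Lemma cauchy_schwarz x y : rnorm (dot x y) <= rnorm x * rnorm y.
Proof.
have [->|y0] := eqVneq y 0; first by rewrite dot0r /rnorm !normr0/= mulr0.
have := sqr_ge0 (rnorm (x - (dot x y / dot y y) *: y)).
rewrite rnorm_proj// subr_ge0 ler_pdivrMr ?exprn_gt0 ?rnorm_gt0// -exprMn.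
by rewrite ler_sqr ?nnegrE ?mulr_ge0 ?rnorm_ge0.
Qed.

Lemma parallelogram x y :
  rnorm (x + y) ^+ 2 + rnorm (x - y) ^+ 2 = 2 * rnorm x ^+ 2 + 2 * rnorm y ^+ 2.
Proof.
apply: (@ofR_inj R); rewrite !ofRD !(ofRM 2) -!dotxx dotBl dotDl !dotBr !dotDr.
by rewrite [ofR 2]rmorph_nat; ring.
Qed.

Definition closed_subspace V :=
  [/\ V 0, forall (a : C) x y, V x -> V y -> V (a *: x + y) & closed V].

Lemma subspaceD V x y : closed_subspace V -> V x -> V y -> V (x + y).
Proof. by move=> [_ VL _] Vx Vy; rewrite -[x]scale1r; apply: VL. Qed.

Lemma subspaceZ V (a : C) x : closed_subspace V -> V x -> V (a *: x).
Proof. by move=> [V0 VL _] Vx; rewrite -[_ *: _]addr0; apply: VL. Qed.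

Lemma subspaceB V x y : closed_subspace V -> V x -> V y -> V (x - y).
Proof.
by move=> [_ VL _] Vx Vy; rewrite addrC -scaleN1r; apply: VL.
Qed.

(** A minimizing sequence for the distance from [x] to [V] is Cauchy by the parallelogram law. Its
    limit is [v], and orthogonality follows by passing to the limit in an estimate along the
    sequence. *)
Lemma projection_ex V x : closed_subspace V ->
  exists2 v, V v & forall z, V z -> dot (x - v) z = 0.
Proof.
move=> subV; have [V0 _ Vcl] := subV.
pose E : set R := [set rnorm (x - v) ^+ 2 | v in V].
have E_inf : has_inf E.
  split; first by exists (rnorm (x - 0) ^+ 2), 0.
  by exists 0 => _ [v _ <-]; exact: sqr_ge0.
pose d := inf E.
have d_le v : V v -> d <= rnorm (x - v) ^+ 2.
  by move=> Vv; apply: (ge_inf E_inf.2); exists v.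
have /choice[u uP] : forall n : nat, exists v,
    V v /\ rnorm (x - v) ^+ 2 < d + n.+1%:R^-1.
  move=> n; have n0 : 0 < n.+1%:R^-1 :> R by rewrite invr_gt0.
  by have [_ [v Vv <-] vn] := inf_adherent n0 E_inf; exists v.
(* The midpoint of [u m] and [u n] lies in [V], so its squared distance to [x] is at least [d]. *)
have u_dist m n : rnorm (u m - u n) ^+ 2 <= 2 * m.+1%:R^-1 + 2 * n.+1%:R^-1.
  have [[Vm um] [Vn un]] := (uP m, uP n).
  have := parallelogram (x - u m) (x - u n).
  have -> : x - u m + (x - u n) = (2 : C) *: (x - (2^-1 : C) *: (u m + u n)).
    rewrite scalerBr scalerA mulfV ?pnatr_eq0// scale1r scaler_nat mulr2n.
    by rewrite opprD addrACA.
  have -> : x - u m - (x - u n) = u n - u m.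
    by rewrite opprB addrC addrA subrK.
  rewrite rnormZ (rnormB (u n)).
  have -> : rnorm (2 : C) = 2 by rewrite -[RHS]rnorm_ofR // /ofR rmorph_nat.
  have := d_le _ (subspaceZ (2^-1) subV (subspaceD subV Vm Vn)).
  rewrite exprMn; move: um un; move: (m.+1%:R^-1) (n.+1%:R^-1) => i j.
  by move: (rnorm _ ^+ 2) (rnorm _ ^+ 2) (rnorm _ ^+ 2) (rnorm _ ^+ 2) => *; lra.
have inv_small (e : R) : 0 < e -> exists N, N.+1%:R^-1 < e.
  move=> e0; exists (Num.truncn e^-1).
  by rewrite invf_plt ?posrE// truncnS_gt.
have [v uv] : exists v, forall e : R, 0 < e ->
    exists N, forall n, (N <= n)%N -> rnorm (u n - v) < e.
  apply: cauchy_rnorm_cvg => e e0.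
  have [N Ne] := inv_small (e ^+ 2 / 4) (divr_gt0 (exprn_gt0 2 e0) (ltr0n _ 4)).
  exists N => n Nn; rewrite -ltr_sqr ?nnegrE ?rnorm_ge0 ?(ltW e0)//.
  apply: le_lt_trans (u_dist _ _) _.
  have : n.+1%:R^-1 <= N.+1%:R^-1 :> R by rewrite lef_pV2 ?posrE// ler_nat.
  by move: Ne; move: (n.+1%:R^-1) (N.+1%:R^-1) => *; lra.
exists v; first exact: closed_rnorm_cvg Vcl (fun n => (uP n).1) uv.
move=> z Vz; apply/eqP; rewrite -rnorm_eq0 eq_le rnorm_ge0 andbT.
have [->|z0] := eqVneq z 0; first by rewrite dot0r /rnorm normr0.
have z_gt0 : 0 < rnorm z by rewrite rnorm_gt0.
(* Correcting [u n] by the best multiple of [z] stays in [V], so the gain given by [rnorm_proj] is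
   at most the excess of [u n] over [d]. *)
have u_dot n : rnorm (dot (x - u n) z) ^+ 2 <= n.+1%:R^-1 * rnorm z ^+ 2.
  have [Vn un] := uP n.
  have := d_le _ (subspaceD subV Vn (subspaceZ (dot (x - u n) z / dot z z) subV Vz)).
  rewrite opprD addrA rnorm_proj// -ler_pdivrMr ?exprn_gt0//.
  move: un; move: (rnorm (x - u n) ^+ 2) (n.+1%:R^-1) (_ / _) => *; lra.
apply/ler_addgt0Pl => e e0.
have [e' e'0 e'E] : exists2 e' : R, 0 < e' & 2 * e' * rnorm z = e.
  exists (e / (2 * rnorm z)); first by rewrite divr_gt0 ?mulr_gt0.
  by field; rewrite gt_eqF.
have [N uN] := uv _ e'0.
have [M Me] := inv_small (e' ^+ 2) (exprn_gt0 2 e'0).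
pose n := maxn N M; have {}uN := uN n (leq_maxl _ _).
have {}Me : n.+1%:R^-1 < e' ^+ 2.
  by apply: le_lt_trans Me; rewrite lef_pV2 ?posrE// ler_nat ltnS leq_maxr.
have -> : dot (x - v) z = dot (x - u n) z + dot (u n - v) z.
  by rewrite -dotDl addrA subrK.
rewrite addr0 (le_trans (rnormD _ _))//.
have le1 : rnorm (dot (x - u n) z) <= e' * rnorm z.
  rewrite -ler_sqr ?nnegrE ?mulr_ge0 ?rnorm_ge0 ?(ltW e'0)//.
  by apply: le_trans (u_dot n) _; rewrite exprMn ler_wpM2r ?sqr_ge0// ltW.
have le2 : rnorm (dot (u n - v) z) <= e' * rnorm z.
  by apply: le_trans (cauchy_schwarz _ _) _; rewrite ler_wpM2r ?rnorm_ge0// ltW.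
lra.
Qed.

End HilbertSpace.

(** * Boundedness, Riesz representation and adjoints *)

Section RieszRepresentation.
Variables (R : realType) (H : completeNormedModType (complexes R)).
Variable dot : {dot H for conjC}.
Hypothesis dot_norm : forall x : H, `|x| ^+ 2 = dot x x.
Local Notation C := (complexes R).
Implicit Types (x y z : H) (V W : set H) (T L : H -> H).

Lemma closed_rnormP (A : set H) :
  (forall x, (forall e : R, 0 < e -> exists2 a, A a & rnorm (x - a) < e) -> A x) ->
  closed A.
Proof.
move=> approx x Ax; apply: approx => e e0.
have [|a [Aa xa]] := Ax (ball x (ofR e)); first by apply: nbhsx_ballx; rewrite ofR_gt0.
by exists a => //; move: xa; rewrite -ball_normE /ball_ /= norm_rnorm ltr_ofR.
Qed.

Lemma bounded_onP (U : normedModType C) V (T : H -> U) :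
  (exists d : C, forall x, V x -> `|T x| <= d * `|x|) <->
  (exists2 d : R, 0 <= d & forall x, V x -> rnorm (T x) <= d * rnorm x).
Proof.
split=> [[d dT]|[d _ dT]]; last first.
  by exists (ofR d) => x /dT; rewrite -ler_ofR ofRM -!norm_rnorm.
exists (rnorm d) => [|x Vx]; first exact: rnorm_ge0.
(* [d] itself need not be real, but its product with the norm of [x] dominates a norm, hence is
   nonnegative and equal to its own norm. *)
have := dT x Vx; rewrite -[d * _]ger0_norm; last exact: le_trans (dT x Vx).
by rewrite normrM normr_id !norm_rnorm -ofRM ler_ofR.
Qed.

Lemma bounded_opP T :
  bounded_op T <-> linear T /\ exists d : C, forall x, `|T x| <= d * `|x|.
Proof.
split=> [[linT contT]|[linT [d dT]]]; split=> //;
  pose T' : {linear H -> H} := HB.pack T (GRing.isLinear.Build _ _ _ _ _ linT).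
  have /(linear_bounded_continuous T')/linear_boundedP : continuous T' by [].
  by move=> /pinfty_ex_gt0[d _ dT]; exists d.
apply: (bounded_linear_continuous (f := T')); apply/linear_boundedP => /=.
have [d' d'0 d'T] := (bounded_onP setT T).1 (ex_intro _ d (fun x _ => dT x)).
near=> r => x; rewrite norm_rnorm (le_trans (y := ofR (d' * rnorm x)))//.
  by rewrite ler_ofR; exact: d'T.
rewrite ofRM -norm_rnorm ler_wpM2r//.
by near: r; apply: nbhs_pinfty_ge; rewrite ger0_real// ofR_ge0.
Unshelve. all: by end_near. Qed.

Lemma bounded_op_on_setT T : bounded_op T <-> bounded_op_on setT T.
Proof.
split=> [/bounded_opP[linT [d dT]]|[_ linT [d dT]]].
  by split=> [||] //; [move=> a x y _ _; exact: linT|exists d => x _; exact: dT].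
by apply/bounded_opP; split=> [a x y|]; [exact: linT|exists d => x; exact: dT].
Qed.

Lemma closed_subspace_setT : closed_subspace (setT : set H).
Proof. by split=> //; exact: closedT. Qed.

Lemma dot_inj V y z : closed_subspace V -> V y -> V z ->
  (forall x, V x -> dot x y = dot x z) -> y = z.
Proof.
move=> subV Vy Vz yz; apply/subr0_eq/(dotxx_eq0 (dot := dot)).
by rewrite dotBr (yz _ (subspaceB subV Vy Vz)) subrr.
Qed.

(** The kernel [K] of [phi] in [V] is closed. Unless it is all of [V], its orthogonal complement in
    [V] is a line, spanned by some [w], and a multiple of [w] represents [phi]. *)
Lemma riesz V (phi : H -> C) : closed_subspace V ->
  (forall a x y, V x -> V y -> phi (a *: x + y) = a * phi x + phi y) ->
  (exists d : C, forall x, V x -> `|phi x| <= d * `|x|) ->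
  exists2 z, V z & forall x, V x -> phi x = dot x z.
Proof.
move=> subV phi_lin /(bounded_onP V (phi : H -> C^o))[d d0 phi_d].
have [V0 VL Vcl] := subV.
pose K : set H := [set x | V x /\ phi x = 0].
have phi0 : phi 0 = 0.
  by have := phi_lin (-1) 0 0 V0 V0; rewrite scaler0 addr0 mulN1r addNr.
have subK : closed_subspace K.
  split=> // [a x y [Vx x0] [Vy y0]|].
    by split; [exact: VL|rewrite phi_lin// x0 y0 mulr0 addr0].
  apply: closed_rnormP => x xK.
  have Vx : V x.
    rewrite [V](closure_id _).1// => B /nbhs_ballP[e e0 eB].
    have [|a [Va _] xa] := xK (complex.Re (e : R[i])).
      by rewrite -ofR_gt0 -ge0_complexE// ltW.
    exists a; split=> //; apply: eB.
    by rewrite -ball_normE /ball_ /= norm_rnorm (ge0_complexE (ltW e0)) ltr_ofR.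
  split=> //; apply/eqP; rewrite -rnorm_eq0 eq_le rnorm_ge0 andbT.
  apply/ler_addgt0Pl => e e0; rewrite addr0.
  (* Adding 1 keeps the divisor positive when [d] is 0. *)
  have d1 : 0 < d + 1 by rewrite ltr_wpDl.
  have [|a [Va a0] xa] := xK (e / (d + 1)); first by rewrite divr_gt0.
  have -> : phi x = phi (x - a).
    by rewrite addrC -scaleN1r phi_lin// a0 mulr0 add0r.
  rewrite (le_trans (phi_d _ (subspaceB subV Vx Va)))//.
  move: xa; rewrite ltr_pdivlMr// => /ltW; apply: le_trans.
  by rewrite mulrC ler_wpM2l ?rnorm_ge0// lerDl.
have [[x0 Vx0 phix0]|K_all] := pselect (exists2 x, V x & phi x != 0); last first.
  exists 0 => // x Vx; rewrite dot0r; apply: contrapT => /eqP xn0.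
  by apply: K_all; exists x.
have [k [Vk k0] kP] := projection_ex dot_norm x0 subK.
pose w := x0 - k.
have Vw : V w by exact: subspaceB.
have phiw : phi w != 0.
  by rewrite /w addrC -scaleN1r phi_lin// k0 mulr0 add0r.
have w0 : dot w w != 0.
  by rewrite dnorm_eq0; apply: contraNneq phiw => ->; rewrite phi0 eqxx.
exists ((phi w / dot w w)^* *: w) => [|x Vx]; first exact: subspaceZ.
(* [phi] vanishes on this combination, which is therefore orthogonal to [w]; this expresses [phi x]
   through [dot x w]. *)
have /kP : K (phi w *: x - phi x *: w).
  split; first by apply: subspaceB => //; exact: subspaceZ.
  rewrite -scaleNr addrC phi_lin//; last exact: subspaceZ.
  by rewrite -[_ *: x]addr0 phi_lin// phi0 addr0 mulNr mulrC addNr.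
rewrite -/w => /dot_eq0C; rewrite dotBl !dotZl => /eqP; rewrite subr_eq0 => /eqP wx.
by rewrite dotZr conjCK mulrAC wx mulfK.
Qed.

(** Riesz shows that the set searched by [xget] is inhabited, so the default value 0 never
    intervenes. *)
Lemma adjoint_onP V T y : closed_subspace V -> bounded_op_on V T ->
  V (adjoint_on dot V T y) /\
  forall x, V x -> dot (T x) y = dot x (adjoint_on dot V T y).
Proof.
move=> subV [TV Tlin /bounded_onP[d d0 dT]].
rewrite /adjoint_on; apply: (@xgetPex _ 0
  [set z | V z /\ forall x, V x -> dot (T x) y = dot x z]).
have [||z Vz zP] := @riesz V (fun x => dot (T x) y) subV; last by exists z.
  by move=> a x z Vx Vz; rewrite Tlin// dotDl dotZl.
apply/(bounded_onP V (fun x => dot (T x) y : C^o)).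
exists (d * rnorm y) => [|x Vx]; first by rewrite mulr_ge0 ?rnorm_ge0.
apply: le_trans (cauchy_schwarz dot_norm _ _) _.
by rewrite mulrAC ler_wpM2r ?rnorm_ge0 ?dT.
Qed.

Lemma adjointP T x y : bounded_op T -> dot (T x) y = dot x (adjoint dot T y).
Proof.
by move=> /bounded_op_on_setT /(adjoint_onP y closed_subspace_setT)[_]; exact.
Qed.

Lemma adjoint_bounded T : bounded_op T -> bounded_op (adjoint dot T).
Proof.
move=> bT; have [_ [d dT]] := (bounded_opP T).1 bT.
have [e e0 eT] := (bounded_onP setT T).1 (ex_intro _ d (fun x _ => dT x)).
apply/bounded_opP; split.
  move=> a x y; apply: (dot_inj closed_subspace_setT) => // z _.
  by rewrite -adjointP// !dotDr !dotZr -!adjointP.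
have [|f fT] := (bounded_onP setT (adjoint dot T)).2; last first.
  by exists f => x; exact: fT.
exists e => // x _; set y := adjoint dot T x.
have [->|y0] := eqVneq y 0; first by rewrite {1}/rnorm normr0 mulr_ge0 ?rnorm_ge0.
rewrite -(ler_pM2r (etrans (rnorm_gt0 y) y0)) -expr2.
(* Since [y] is the adjoint of [T] at [x], [dot (T y) x = dot y y]; Cauchy-Schwarz then leaves a
   common factor [rnorm y]. *)
have -> : rnorm y ^+ 2 = rnorm (dot (T y) x).
  by rewrite adjointP// dotxx// rnorm_ofR ?sqr_ge0.
apply: le_trans (cauchy_schwarz dot_norm _ _) _.
by rewrite mulrAC ler_wpM2r ?rnorm_ge0 ?eT.
Qed.

End RieszRepresentation.

(** * Uniform boundedness and the Hellinger-Toeplitz theorem *)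

Section HellingerToeplitz.
Variables (R : realType) (H : completeNormedModType (complexes R)).
Variable dot : {dot H for conjC}.
Hypothesis dot_norm : forall x : H, `|x| ^+ 2 = dot x x.
Local Notation C := (complexes R).
Implicit Types (x y z : H) (W : set H) (L : H -> H).

Lemma natr_expr4V_le1 n : n.+1%:R * 4^-1 ^+ n <= 1 :> R.
Proof.
rewrite exprVn -natrX ler_pdivrMr ?ltr0n ?expn_gt0// mul1r ler_nat.
exact: ltn_expl.
Qed.

(** The factor 4/3 is the sum of the powers of 1/4; the induction on [m] closes once the term
    [- q m] is carried along. *)
Lemma geometric_steps_bound (u : H^nat) (q : R^nat) :
  (forall n, q n.+1 = q n / 4) -> (forall n, 0 <= q n) ->
  (forall n, rnorm (u n.+1 - u n) <= q n) ->
  forall n m, (n <= m)%N -> rnorm (u m - u n) <= 4 / 3 * q n.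
Proof.
move=> qS q0 uS n m nm.
suff : rnorm (u m - u n) <= 4 / 3 * (q n - q m).
  by move=> /le_trans; apply; rewrite ler_wpM2l// gerBl.
elim: m nm => [|m IH].
  by rewrite leqn0 => /eqP ->; rewrite !subrr mulr0 /rnorm normr0.
rewrite leq_eqVlt ltnS => /orP[/eqP ->|/IH {}IH].
  by rewrite !subrr mulr0 /rnorm normr0.
have -> : u m.+1 - u n = (u m.+1 - u m) + (u m - u n) by rewrite addrA subrK.
rewrite (le_trans (rnormD _ _))// (le_trans (lerD (uS m) IH))// qS.
by move: (q m) (q n) => *; lra.
Qed.

(* Gliding hump, after A. Sokal: if (w n) is unbounded, then x moves by at most
   4^-n at step n so as to make dot x (w n) large, which the later steps
   cannot undo. *)
Lemma weakly_bounded W :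
  (forall x, exists M : R, forall w, W w -> rnorm (dot x w) <= M) ->
  exists M : R, forall w, W w -> rnorm w <= M.
Proof.
move=> weak; apply: contrapT => unbounded.
have /choice[w wP] : forall n : nat, exists w, W w /\ n%:R * 4 ^+ n < rnorm w.
  move=> n; apply: contrapT => wn; apply: unbounded.
  exists (n%:R * 4 ^+ n) => w Ww; rewrite leNgt; apply/negP => nw.
  by apply: wn; exists w.
pose q n : R := 4^-1 ^+ n.
have q_gt0 n : 0 < q n by rewrite exprn_gt0// invr_gt0.
have w_gt0 n : 0 < rnorm (w n).
  by apply: le_lt_trans (wP n).2; rewrite mulr_ge0// exprn_ge0.
pose h n : H := ofR (q n / rnorm (w n)) *: w n.
have h_norm n : rnorm (h n) = q n.
  rewrite rnormZ rnorm_ofR ?divr_ge0 ?rnorm_ge0 ?(ltW (q_gt0 n))//.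
  by rewrite divfK// gt_eqF.
have h_dot n : dot (h n) (w n) = ofR (q n * rnorm (w n)).
  by rewrite dotZl dotxx// -ofRM expr2 mulrA divfK// gt_eqF.
(* [dot x (w n)] and [dot (x + h n) (w n)] differ by [q n * rnorm (w n)], so one of them has norm at
   least half of that. *)
pose step n x := if q n * rnorm (w n) / 2 <= rnorm (dot x (w n)) then x else x + h n.
have [u uS] : exists u : H^nat, forall n, u n.+1 = step n (u n).
  by exists (fix u n := if n is n'.+1 then step n' (u n') else 0).
have u_step n : rnorm (u n.+1 - u n) <= q n.
  rewrite uS /step; case: ifP => _.
    by rewrite subrr /rnorm normr0 ltW.
  by rewrite addrC addKr h_norm.
have u_dot n : q n * rnorm (w n) / 2 <= rnorm (dot (u n.+1) (w n)).
  rewrite uS /step; case: ifPn => //; rewrite -ltNge => small.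
  have hE : dot (h n) (w n) = dot (u n + h n) (w n) - dot (u n) (w n).
    by rewrite dotDl addrAC subrr add0r.
  have := rnormD (dot (u n + h n) (w n)) (- dot (u n) (w n)).
  rewrite -hE h_dot rnormN rnorm_ofR ?mulr_ge0 ?rnorm_ge0 ?(ltW (q_gt0 n))//.
  have aux (a b c : R) : a < c / 2 -> c <= b + a -> c / 2 <= b by lra.
  exact: aux small.
have u_tail := geometric_steps_bound
  (fun n => exprSr _ n) (fun n => ltW (q_gt0 n)) u_step.
have [l ul] : exists l, forall e : R, 0 < e ->
    exists N, forall n, (N <= n)%N -> rnorm (u n - l) < e.
  apply: cauchy_rnorm_cvg => e e0.
  (* This gives [4 / 3 < (N + 1) * e], which [natr_expr4V_le1] turns into [4 / 3 * q N < e]. *)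
  pose N := Num.truncn (4 / 3 / e).
  exists N => n Nn; apply: le_lt_trans (u_tail _ _ Nn) _.
  have Ne : 4 / 3 < N.+1%:R * e by rewrite -ltr_pdivrMr// truncnS_gt.
  rewrite -(ltr_pM2r (q_gt0 N)) in Ne; apply: lt_le_trans Ne _.
  by rewrite mulrAC ler_piMl ?(ltW e0) ?natr_expr4V_le1.
have [M lM] := weak l.
(* The moves after step [n] total at most [q n / 3], and approximating [l] costs another [q n / 12],
   together [5 / 12 * q n]. What remains of the half secured by [u_dot] is a twelfth, hence the
   threshold [12 * M]. *)
pose n := (Num.truncn (12 * M)).+1.
have qw : n%:R < q n * rnorm (w n).
  have := (wP n).2; rewrite -(ltr_pM2l (q_gt0 n)); apply: le_lt_trans.
  by rewrite mulrCA -exprMn mulVf// expr1n mulr1.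
have qn12 : 0 < q n / 12 by rewrite divr_gt0.
have [N uN] := ul _ qn12.
pose m := maxn N n.+1.
have {}uN := uN m (leq_maxl _ _).
have uM := u_tail _ _ (leq_maxr N n.+1).
have close : rnorm (u n.+1 - l) <= 5 / 12 * q n.
  have -> : u n.+1 - l = (u m - l) - (u m - u n.+1).
    by rewrite opprB [RHS]addrC addrA subrK.
  apply: le_trans (rnormD _ _) _; rewrite rnormN.
  have aux (a b c : R) : a < c / 12 -> b <= 4 / 3 * (c / 4) -> a + b <= 5 / 12 * c.
    by lra.
  by apply: aux uN _; rewrite -exprSr.
have lw : rnorm (dot (u n.+1) (w n)) <=
    rnorm (dot l (w n)) + 5 / 12 * (q n * rnorm (w n)).
  have -> : dot (u n.+1) (w n) = dot l (w n) + dot (u n.+1 - l) (w n).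
    by rewrite -dotDl addrC subrK.
  apply: le_trans (rnormD _ _) _; rewrite lerD2l.
  apply: le_trans (cauchy_schwarz dot_norm _ _) _.
  by rewrite mulrA ler_wpM2r// rnorm_ge0.
have nM : 12 * M < n%:R by rewrite truncnS_gt.
have aux (a b c : R) : a / 2 <= b -> b <= M + 5 / 12 * a -> 12 * M < c -> c < a -> False.
  by lra.
apply: aux (u_dot n) (le_trans lw _) nM qw.
by rewrite lerD2r (lM _ (wP n).1).
Qed.

(** For [y] in the unit ball, [dot x (L y) = dot (L x) y] is bounded by [rnorm (L x)]; the image of
    the ball is thus weakly bounded, hence bounded. Linearity comes from symmetry as well. *)
Lemma symmetric_bounded L :
  (forall x y, dot (L x) y = dot x (L y)) -> bounded_op L.
Proof.
move=> symL.
have linL : linear L.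
  move=> a x y; apply: (dot_inj (dot := dot) (closed_subspace_setT H)) => // z _.
  by rewrite -symL !dotDr !dotZr -!symL.
have L0 : L 0 = 0.
  by have := linL (-1) 0 0; rewrite scaler0 addr0 scaleN1r addNr.
have [|M LM] := @weakly_bounded [set L y | y in [set y | rnorm y <= 1]].
  move=> x; exists (rnorm (L x)) => _ [y y1 <-]; rewrite -symL.
  apply: le_trans (cauchy_schwarz dot_norm _ _) _.
  by rewrite ler_piMr ?rnorm_ge0.
have M0 : 0 <= M.
  rewrite (le_trans _ (LM 0 _)) ?rnorm_ge0//.
  by exists 0; rewrite //= /rnorm normr0.
apply/bounded_opP; split=> //.
have [|d dL] := (bounded_onP setT L).2; last by exists d => x; exact: dL.
exists M => // x _; have [->|x0] := eqVneq x 0.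
  by rewrite L0 /rnorm normr0 mulr0.
have x_gt0 : 0 < rnorm x by rewrite rnorm_gt0.
have := LM (ofR (rnorm x)^-1 *: L x) _.
rewrite rnormZ rnorm_ofR ?invr_ge0 ?rnorm_ge0// ler_pdivrMl// mulrC; apply.
exists (ofR (rnorm x)^-1 *: x).
  by rewrite /= rnormZ rnorm_ofR ?invr_ge0 ?rnorm_ge0// mulVf ?gt_eqF.
by have := linL (ofR (rnorm x)^-1) x 0; rewrite !addr0 L0 addr0.
Qed.

End HellingerToeplitz.

(** * Polarization and symmetry of positive operators *)

Section PositiveOperators.
Variables (R : realType) (H : completeNormedModType (complexes R)).
Variable dot : {dot H for conjC}.
Local Notation C := (complexes R).
Implicit Types (x y z : H) (V : set H) (T : H -> H).

(** Expanding at [x + y] and at ['i *: x + y] gives [B x y + B y x = 0] and [B x y - B y x = 0]. *)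
Lemma polarization V (B : H -> H -> C) : closed_subspace V ->
  (forall a x y z, V x -> V y -> V z -> B (a *: x + y) z = a * B x z + B y z) ->
  (forall a x y z, V x -> V y -> V z -> B z (a *: x + y) = a^* * B z x + B z y) ->
  (forall x, V x -> B x x = 0) ->
  forall x y, V x -> V y -> B x y = 0.
Proof.
move=> subV Bl Br B0 x y Vx Vy; have [_ VL _] := subV.
have := B0 _ (VL 1 _ _ Vx Vy); rewrite Bl ?Br//; last exact: VL.
have := B0 _ (VL 'i _ _ Vx Vy); rewrite Bl ?Br//; last exact: VL.
rewrite !B0// conjCi conjC1 !mul1r !mulr0 !add0r !addr0 mulNr -mulrBr.
move/eqP; rewrite mulf_eq0 (negbTE (neq0Ci _)) /= subr_eq0 => /eqP <- /eqP.
by rewrite -mulr2n mulrn_eq0 => /eqP.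
Qed.

Lemma linear_opB T : linear T -> forall x y, T (x - y) = T x - T y.
Proof. by move=> linT x y; rewrite addrC -scaleN1r linT scaleN1r addrC. Qed.

(** Positivity makes [dot (T x) x] real, so the defect of symmetry is a sesquilinear form that
    vanishes on the diagonal. *)
Lemma positive_symmetric T : linear T -> positive_op dot T ->
  forall x y, dot (T x) y = dot x (T y).
Proof.
move=> linT posT x y; apply/eqP; rewrite -subr_eq0; apply/eqP.
apply: (@polarization setT (fun x y => dot (T x) y - dot x (T y))) => //.
- by move=> a u v w _ _ _; rewrite linT !dotDl !dotZl; ring.
- by move=> a u v w _ _ _; rewrite linT !dotDr !dotZr; ring.
- by move=> u _; rewrite [dot u _]dotC geC0_conj ?subrr.
Qed.

End PositiveOperators.

(** * The Moore-Penrose inverse of a symmetric operator with closed range *)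

Section ClosedRange.
Variables (R : realType) (H : completeNormedModType (complexes R)).
Variable dot : {dot H for conjC}.
Hypothesis dot_norm : forall x : H, `|x| ^+ 2 = dot x x.
Variables (V : set H) (S : H -> H).
Hypothesis subV : closed_subspace V.
Hypothesis bS : bounded_op S.
Hypothesis symS : forall x y, dot (S x) y = dot x (S y).
Hypothesis rangeS : range S = V.
Local Notation C := (complexes R).
Local Notation L := (mp_inverse dot S).
Implicit Types (x y z : H) (T F : H -> H).

Lemma range_mem x : V (S x). Proof. by rewrite -rangeS; exists x. Qed.

Lemma kerP u : S u = 0 <-> forall v, V v -> dot u v = 0.
Proof.
split=> [Su v|uV]; first by rewrite -rangeS => -[w _ <-]; rewrite -symS Su dot0l.
by apply: (dotxx_eq0 (dot := dot)); rewrite symS uV//; exact: range_mem.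
Qed.

Let linSB x y : S (x - y) = S x - S y.
Proof. exact: linear_opB bS.1 x y. Qed.

(** The component of [x] orthogonal to [V] lies in [ker S], so it is orthogonal to [x] and to the
    projection of [x], hence to itself. *)
Lemma ker_ortho_mem x : (forall u, S u = 0 -> dot x u = 0) -> V x.
Proof.
move=> xker; have [v Vv xv] := projection_ex dot_norm x subV.
have Su : S (x - v) = 0 by apply/kerP.
have /subr0_eq -> // : x - v = 0.
apply: (dotxx_eq0 (dot := dot)); rewrite dotBl xker// (dot_eq0C (xv _ Vv)).
by rewrite subrr.
Qed.

Lemma injS x y : V x -> V y -> S x = S y -> x = y.
Proof.
move=> Vx Vy Sxy; apply/subr0_eq/(dotxx_eq0 (dot := dot)).
by apply: (kerP _).1; [rewrite linSB Sxy subrr|exact: subspaceB].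
Qed.

(** Because [V] is closed, every [y] splits along [V] and its complement, so [L] never takes its
    default value. *)
Lemma mp_inverseP y : V (L y) /\ forall v, V v -> dot (y - S (L y)) v = 0.
Proof.
have [p Vp yp] := projection_ex dot_norm y subV.
have [w _ wp] : range S p by rewrite rangeS.
(* Projecting the preimage [w] onto [V] removes its component in [ker S] without changing its
   image. *)
have [w1 Vw1 ww1] := projection_ex dot_norm w subV.
have Sw1 : S w1 = p.
  by rewrite -wp; apply/esym/subr0_eq; rewrite -linSB; apply/kerP.
have [|Lker Lran] := @xgetPex _ 0 [set x | (forall z, S z = 0 -> dot x z = 0) /\
                  (forall z, dot (y - S x) (S z) = 0)].
  exists w1; split=> [z /kerP zV|z]; first exact/dot_eq0C/zV.
  by rewrite Sw1; apply: yp; exact: range_mem.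
split; first exact: ker_ortho_mem.
by move=> v; rewrite -rangeS => -[z _ <-]; exact: Lran.
Qed.

Lemma mp_inverse_mem y : V (L y). Proof. exact: (mp_inverseP y).1. Qed.

Lemma mp_inverseK x : V x -> S (L x) = x.
Proof.
move=> Vx; apply/esym/subr0_eq/(dotxx_eq0 (dot := dot)).
by apply: (mp_inverseP x).2; apply: subspaceB => //; exact: range_mem.
Qed.

Lemma mp_inverseVK x : V x -> L (S x) = x.
Proof.
move=> Vx; apply: injS => //; first exact: mp_inverse_mem.
exact/mp_inverseK/range_mem.
Qed.

(** Both sides equal [dot (S (L x)) (L y)], because [S L] is the orthogonal projection onto [V]. *)
Lemma mp_inverse_sym x y : dot (L x) y = dot x (L y).
Proof.
have H1 u v : dot (L u) v = dot (L u) (S (L v)).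
  apply/eqP; rewrite -subr_eq0 -dotBr; apply/eqP/dot_eq0C.
  by apply: (mp_inverseP v).2; exact: mp_inverse_mem.
rewrite H1 -symS; apply/esym; rewrite dotC H1 -dotC.
by rewrite dotC.
Qed.

Lemma mp_inverse_bounded : bounded_op L.
Proof. apply: (symmetric_bounded dot_norm) => x y; exact: mp_inverse_sym. Qed.

Lemma ker_subL x : S (L (S x) - x) = 0.
Proof. by rewrite linSB mp_inverseK ?subrr//; exact: range_mem. Qed.

(** [V] is the orthogonal complement of [ker S], and pairing [T^* S x] with [u] in [ker S] gives
    [dot x (S (T u))]. *)
Lemma B_sqrtAP T : B_sqrtA dot S T <->
  bounded_op T /\ forall x, S x = 0 -> S (T x) = 0.
Proof.
split=> [[bT ranT]|[bT kerT]]; split=> //.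
  move=> x Sx; apply: (dotxx_eq0 (dot := dot)); rewrite symS (adjointP dot_norm)//.
  have [w _ <-] : range S (adjoint dot T (S (S (T x)))).
    by apply: ranT; exists (S (T x)).
  by rewrite -symS Sx dot0l.
move=> _ [x _ <-]; rewrite rangeS; apply: ker_ortho_mem => u Su.
by apply/dot_eq0C; rewrite -(adjointP dot_norm)// -symS kerT// dot0l.
Qed.

(** [L S] is the orthogonal projection onto [V], and [T] keeps the discarded component inside
    [ker S]. *)
Lemma B_sqrtA_mp T x : B_sqrtA dot S T -> S (T (L (S x))) = S (T x).
Proof.
move=> /B_sqrtAP[bT kerT]; apply/subr0_eq; rewrite -linSB.
rewrite -(linear_opB bT.1).
exact/kerT/ker_subL.
Qed.

End ClosedRange.

(** * Composition of bounded operators; operators that agree on [V] *)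

Section BoundedOperators.
Variables (R : realType) (H : completeNormedModType (complexes R)).
Local Notation C := (complexes R).
Implicit Types (x y z : H) (V : set H) (T : H -> H).

Lemma bounded_op_comp V T1 T2 T3 : bounded_op T1 -> bounded_op_on V T2 ->
  bounded_op T3 -> (forall x, V (T3 x)) -> bounded_op (T1 \o T2 \o T3).
Proof.
move=> /bounded_op_on_setT[_ lin1 /bounded_onP[d1 d1_0 T1d]].
move=> [V2 lin2 /bounded_onP[d2 d2_0 T2d]].
move=> /bounded_op_on_setT[_ lin3 /bounded_onP[d3 d3_0 T3d]] V3.
apply/bounded_op_on_setT; split=> // [a x y _ _|] /=.
  by rewrite lin3// lin2// lin1.
apply/bounded_onP; exists (d1 * (d2 * d3)) => [|x _ /=]; first by rewrite !mulr_ge0.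
rewrite (le_trans (T1d _ _))// -mulrA ler_wpM2l// (le_trans (T2d _ (V3 x)))//.
by rewrite -mulrA ler_wpM2l// T3d.
Qed.

Lemma bounded_op_on_comp V T1 T2 T3 : bounded_op T1 -> bounded_op T2 ->
  bounded_op T3 -> (forall x, V (T1 x)) -> bounded_op_on V (T1 \o T2 \o T3).
Proof.
move=> b1 /bounded_op_on_setT b2 b3 V1.
have /bounded_op_on_setT[_ lin [d dT]] := bounded_op_comp b1 b2 b3 (fun=> I).
by split=> [x _|a x y _ _|]; [exact: V1|exact: lin|exists d => x _; exact: dT].
Qed.

Lemma bounded_op_scalarB l T : bounded_op T -> bounded_op (fun x => l *: x - T x).
Proof.
move=> [linT contT]; split=> [a x y|x].
  by rewrite linT scalerDr opprD addrACA scalerBr !scalerA mulrC.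
by apply: cvgB; [apply: cvgZr; exact: cvg_id|exact: contT].
Qed.

Lemma bounded_op_on0 V T : V 0 -> bounded_op_on V T -> T 0 = 0.
Proof.
by move=> V0 [_ /(_ (-1) 0 0 V0 V0) + _]; rewrite scaler0 addr0 scaleN1r addNr.
Qed.

Lemma invertible_on_ext V T1 T2 : (forall x, V x -> T1 x = T2 x) ->
  invertible_on V T1 <-> invertible_on V T2.
Proof.
move=> T12; split=> -[T' bT' T'P]; exists T' => // x Vx;
  have [[VT' _ _] [TP1 TP2]] := (bT', T'P x Vx).
  by rewrite -T12// -T12//; exact: VT'.
by rewrite T12// T12//; exact: VT'.
Qed.

Lemma spectrum_on_ext V T1 T2 : (forall x, V x -> T1 x = T2 x) ->
  spectrum_on V T1 = spectrum_on V T2.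
Proof.
move=> T12; apply/seteqP; split=> l /=;
  by apply: contra_not; apply: (invertible_on_ext _).1 => x Vx; rewrite T12.
Qed.

End BoundedOperators.

(** * A-invertibility as invertibility on the range *)

Section AInvertibility.
Variables (R : realType) (H : completeNormedModType (complexes R)).
Variable dot : {dot H for conjC}.
Hypothesis dot_norm : forall x : H, `|x| ^+ 2 = dot x x.
Variables (V : set H) (S : H -> H).
Hypothesis subV : closed_subspace V.
Hypothesis V_neq0 : exists2 v, V v & v != 0.
Hypothesis bS : bounded_op S.
Hypothesis symS : forall x y, dot (S x) y = dot x (S y).
Hypothesis rangeS : range S = V.
Local Notation C := (complexes R).
Local Notation L := (mp_inverse dot S).
Implicit Types (x y z : H) (T F : H -> H).

Let SV x : V (S x). Proof. by rewrite -rangeS; exists x. Qed.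
Let LV x : V (L x). Proof. exact: mp_inverse_mem. Qed.
Let LK x : V x -> S (L x) = x. Proof. exact: mp_inverseK. Qed.
Let bL : bounded_op L. Proof. exact: (@mp_inverse_bounded _ _ _ dot_norm V). Qed.
Let S0 : S 0 = 0.
Proof. by have := linear_opB bS.1 0 0; rewrite !subrr. Qed.
Let BP T : B_sqrtA dot S T <-> bounded_op T /\ forall x, S x = 0 -> S (T x) = 0.
Proof. exact: (B_sqrtAP dot_norm subV). Qed.
Let inj x y : V x -> V y -> S x = S y -> x = y.
Proof. exact: (injS subV bS symS rangeS). Qed.
Let BK T x : B_sqrtA dot S T -> S (T (L (S x))) = S (T x).
Proof. exact: (B_sqrtA_mp dot_norm subV). Qed.

Lemma B_sqrtA_lift F : bounded_op_on V F -> B_sqrtA dot S (L \o F \o S).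
Proof.
move=> bF; apply/BP; split; first exact: bounded_op_comp bL bF bS SV.
have [VF _ _] := bF; have [V0 _ _] := subV.
by move=> x /= ->; rewrite LK ?(bounded_op_on0 V0 bF)//; exact: VF.
Qed.

Lemma B_sqrtA_scalarB l T : B_sqrtA dot S T -> B_sqrtA dot S (fun x => l *: x - T x).
Proof.
move=> /BP[bT kerT]; apply/BP; split; first exact: bounded_op_scalarB.
move=> x Sx; rewrite (linear_opB bS.1) kerT// subr0.
by have := bS.1 l x 0; rewrite !addr0 Sx S0 scaler0 addr0.
Qed.

(** An A-inverse [Q] of [T] yields the inverse [S Q L] on [V], one factor [S] cancelling by
    injectivity on [V]; an inverse [Q] on [V] comes back as [L Q S]. *)
Lemma A_invertibleP T : B_sqrtA dot S T ->
  A_invertible dot (S \o S) S T <-> invertible_on V (S \o T \o L).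
Proof.
move=> BT; have [bT kerT] := (BP T).1 BT.
split=> [[_ _ [Q [BQ _ TQ QT]]]|[Q bQ QP]].
  have [bQ _] := (BP Q).1 BQ.
  exists (S \o Q \o L) => [|x Vx /=]; first exact: bounded_op_on_comp.
  split; rewrite BK//.
    have := congr1 (fun F => F (L x)) QT => /= /inj -> //; exact: LK.
  have := congr1 (fun F => F (L x)) TQ => /= /inj -> //; exact: LK.
have BQ := B_sqrtA_lift bQ; have [VQ _ _] := bQ.
pose Q' := L \o Q \o S.
have TQ : S \o S \o T \o Q' = S \o S.
  by apply/funext => x /=; have [_ /= ->] := QP _ (SV x).
have QT : S \o S \o Q' \o T = S \o S.
  apply/funext => x /=; rewrite LK; last exact: VQ.
  by rewrite -(BK x BT); have [/= -> _] := QP _ (SV x).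
(* A-invertibility also asks that [T] and its A-inverse be non-zero: if either vanished, so would
   [S (S v)]. *)
have [v Vv v0] := V_neq0.
have SSv : S (S v) != 0.
  have [V0 _ _] := subV; apply: contra_neq v0 => SSv.
  by apply: inj => //; apply: inj => //; rewrite S0 // SSv S0.
split=> //.
  exists (Q' v); apply: contra_neq SSv => TQv.
  by have /= <- := congr1 (fun F => F v) TQ; rewrite TQv !S0.
exists Q'; split=> //.
exists (T v); apply: contra_neq SSv => QTv.
by have /= <- := congr1 (fun F => F v) QT; rewrite QTv !S0.
Qed.

Lemma A_spectrumE T : B_sqrtA dot S T ->
  A_spectrum dot (S \o S) S T = spectrum_on V (S \o T \o L).
Proof.
move=> BT; rewrite /A_spectrum; apply/seteqP.
have E l : A_invertible dot (S \o S) S (fun x => l *: x - T x) <->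
    invertible_on V (fun x => l *: x - (S \o T \o L) x).
  rewrite (A_invertibleP (B_sqrtA_scalarB l BT)).
  apply: invertible_on_ext => x Vx /=; rewrite (linear_opB bS.1).
  have := bS.1 l (L x) 0; rewrite !addr0 => ->.
  by rewrite S0 addr0 LK.
by split=> l /=; apply: contra_not => /E.
Qed.

Lemma A_spectrum_lift F : bounded_op_on V F ->
  A_spectrum dot (S \o S) S (L \o F \o S) = spectrum_on V F.
Proof.
move=> bF; rewrite A_spectrumE; last exact: B_sqrtA_lift.
have [VF _ _] := bF.
by apply: spectrum_on_ext => x Vx /=; rewrite !LK//; exact: VF.
Qed.

End AInvertibility.

(** * Spectral mapping for the continuous functional calculus *)

Section SpectralMapping.
Variables (R : realType) (H : completeNormedModType (complexes R)).
Variable dot : {dot H for conjC}.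
Local Notation C := (complexes R).
Variables (V : set H) (N : H -> H) (Phi : (C -> C) -> H -> H).
Hypothesis fc : is_functional_calculus dot V N Phi.
Local Notation sigma := (spectrum_on V N).
Implicit Types (f g : C -> C).

Lemma within_continuous_cst (l : C) : {within sigma, continuous (fun=> l : C)}.
Proof. by move=> z; exact: cvg_cst. Qed.

Lemma within_continuous_scalarB l f : {within sigma, continuous f} ->
  {within sigma, continuous (fun z => l - f z)}.
Proof. by move=> cf z; apply: cvgB; [exact: cvg_cst|exact: cf]. Qed.

Lemma within_continuousM f g : {within sigma, continuous f} ->
  {within sigma, continuous g} -> {within sigma, continuous (fun z => f z * g z)}.
Proof. by move=> cf cg z; apply: cvgM; [exact: cf|exact: cg]. Qed.

Lemma within_continuousV f : {within sigma, continuous f} ->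
  (forall z, sigma z -> f z != 0) -> {within sigma, continuous (fun z => (f z)^-1)}.
Proof.
move=> /subspace_continuousP cf f0; apply/subspace_continuousP => z sz.
by apply: cvgV; [exact: f0|exact: cf].
Qed.

(** The difference vanishes on the spectrum, so the isometry with bound 0 kills its image under
    [Phi]. *)
Lemma fc_ext f g : {within sigma, continuous f} -> {within sigma, continuous g} ->
  (forall z, sigma z -> f z = g z) -> forall x, V x -> Phi f x = Phi g x.
Proof.
move=> cf cg fg x Vx.
have ch : {within sigma, continuous (fun z => -1 * f z + g z)}.
  by move=> z; apply: cvgD; [apply: cvgM; [exact: cvg_cst|exact: cf]|exact: cg].
have h0 z : sigma z -> `|-1 * f z + g z| <= 0.
  by move=> /fg ->; rewrite mulN1r addNr normr0.
have := (fc_isometry fc ch (lexx 0)).2 h0 x Vx.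
rewrite mul0r normr_le0 (fc_linear fc _ cf cg)// scaleN1r addrC subr_eq0.
by move=> /eqP.
Qed.

Lemma fc_scalarB l f x : {within sigma, continuous f} -> V x ->
  Phi (fun z => l - f z) x = l *: x - Phi f x.
Proof.
move=> cf Vx.
have c1 := @within_continuous_cst 1; have c0 := @within_continuous_cst 0.
have Phi0 : Phi (fun=> 0) x = 0.
  have := fc_linear fc (-1) c1 c1 Vx; rewrite scaleN1r addNr => <-.
  by congr (Phi _ x); apply/funext => z; rewrite mulN1r addNr.
have Phil : Phi (fun=> l) x = l *: x.
  have := fc_linear fc l c1 c0 Vx; rewrite Phi0 (fc_one fc)// [RHS]addr0 => <-.
  by congr (Phi _ x); apply/funext => z; rewrite mulr1 addr0.
have := fc_linear fc (-1) cf (@within_continuous_cst l) Vx.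
rewrite Phil scaleN1r addrC => <-.
by congr (Phi _ x); apply/funext => z; rewrite mulN1r addrC.
Qed.

(** If [f] omits [l], then [Phi] of [(l - f)^-1] inverts [l - Phi f]. Conversely, a bounded inverse
    of [f z0 - Phi f] contradicts the isometry for a function that peaks at [z0]. *)
Lemma spectrum_on_fc f : {within sigma, continuous f} ->
  spectrum_on V (Phi f) = f @` sigma.
Proof.
move=> cf; apply/seteqP; split=> l /=.
  apply: contra_notP => fl.
  have lf z : sigma z -> l - f z != 0.
    by move=> sz; rewrite subr_eq0; apply/eqP => lfz; apply: fl; exists z.
  have ch := within_continuous_scalarB (l := l) cf.
  have cg := within_continuousV ch lf.
  have c1 := @within_continuous_cst 1.
  have [VPhig _ _] := fc_bounded fc cg.
  exists (Phi (fun z => (l - f z)^-1)) => [|x Vx]; first exact: fc_bounded fc _ cg.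
  have Vg := VPhig x Vx.
  rewrite -(fc_scalarB l cf Vx) -(fc_scalarB l cf Vg).
  rewrite -(fc_mul fc cg ch Vx) -(fc_mul fc ch cg Vx).
  rewrite -[X in _ = X /\ _](fc_one fc Vx) -[X in _ /\ _ = X](fc_one fc Vx).
  split.
    apply: (fc_ext (within_continuousM cg ch) c1) => // z sz.
    by rewrite mulVf ?lf.
  apply: (fc_ext (within_continuousM ch cg) c1) => // z sz.
  by rewrite mulfV ?lf.
move=> [z0 sz0 <-] [Q [VQ Qlin /bounded_onP[d d0 Qd]] QP].
pose k : R := d + 1.
have k0 : 0 < k by rewrite ltr_wpDl.
pose h z : C := f z0 - f z.
have ch : {within sigma, continuous h} := within_continuous_scalarB (l := f z0) cf.
(* [`|h| <= k^-1 * q] on sigma, whereas [q^-1] takes the value 1 at [z0]. *)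
pose q z : C := 1 + ofR k * `|h z|.
have cq : {within sigma, continuous q}.
  move=> z; apply: cvgD; first exact: cvg_cst.
  by apply: cvgM; [exact: cvg_cst|apply: cvg_norm; exact: ch].
have q_gt0 z : 0 < q z by rewrite ltr_pwDl// mulr_ge0// ofR_ge0 ltW.
have cg : {within sigma, continuous (fun z => (q z)^-1)}.
  by apply: within_continuousV => // z _; rewrite gt_eqF.
have chg := within_continuousM ch cg.
have hg z : `|h z * (q z)^-1| <= ofR k^-1.
  rewrite normrM normfV (gtr0_norm (q_gt0 z)) ler_pdivrMr//.
  rewrite [ofR _]fmorphV/= ler_pdivlMl ?ofR_gt0// /q.
  by rewrite lerDr.
have Phi_hg x : V x -> `|Phi (fun z => h z * (q z)^-1) x| <= ofR k^-1 * `|x|.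
  apply: (fc_isometry fc chg _).2 => [|z _]; last exact: hg.
  by rewrite ofR_ge0 invr_ge0 ltW.
have [VPhig _ _] := fc_bounded fc cg.
(* [Phi] of [q^-1] is [Q] after [Phi] of [h * q^-1], hence bounded by [d / k], which is less than
   1. *)
have Phi_g x : V x -> `|Phi (fun z => (q z)^-1) x| <= ofR (d / k) * `|x|.
  move=> Vx; have Vg := VPhig x Vx.
  have [<- _] := QP _ Vg; rewrite -(fc_scalarB (f z0) cf Vg) -(fc_mul fc ch cg Vx).
  have Vhg : V (Phi (fun z => h z * (q z)^-1) x).
    by have [VPhi _ _] := fc_bounded fc chg; exact: VPhi.
  rewrite !norm_rnorm -ofRM ler_ofR (le_trans (Qd _ Vhg))// -mulrA ler_wpM2l//.
  by have := Phi_hg x Vx; rewrite !norm_rnorm -ofRM ler_ofR.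
have dk0 : 0 <= ofR (d / k) by rewrite ofR_ge0 divr_ge0// ltW.
have := (fc_isometry fc cg dk0).1 Phi_g z0 sz0.
rewrite /q /h subrr normr0 mulr0 addr0 invr1 normr1.
rewrite -[1]/(ofR 1) ler_ofR ler_pdivlMr// mul1r.
by rewrite /k gerDl ler10.
Qed.

End SpectralMapping.

(** * The adjoint of [T_a], and A-normality as normality on the range *)

Section AReduction.
Variables (R : realType) (H : completeNormedModType (complexes R)).
Variable dot : {dot H for conjC}.
Hypothesis dot_norm : forall x : H, `|x| ^+ 2 = dot x x.
Variables (V : set H) (S T : H -> H).
Hypothesis subV : closed_subspace V.
Hypothesis bS : bounded_op S.
Hypothesis symS : forall x y, dot (S x) y = dot x (S y).
Hypothesis rangeS : range S = V.
Local Notation C := (complexes R).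
Local Notation L := (mp_inverse dot S).
Local Notation Ta_star := (adjoint_on dot V (op_a dot S T)).
Implicit Types (x y z : H).

Let SV x : V (S x). Proof. by rewrite -rangeS; exists x. Qed.
Let LV x : V (L x). Proof. exact: mp_inverse_mem. Qed.
Let LK x : V x -> S (L x) = x. Proof. exact: mp_inverseK. Qed.
Let LVK x : V x -> L (S x) = x. Proof. exact: mp_inverseVK. Qed.
Let bL : bounded_op L. Proof. exact: (@mp_inverse_bounded _ _ _ dot_norm V). Qed.
Let symL x y : dot (L x) y = dot x (L y).
Proof. exact: (@mp_inverse_sym _ _ _ dot_norm V). Qed.

Lemma op_a_dot x y : bounded_op T -> dot (op_a dot S T x) y = dot x (S (T (L y))).
Proof.
by move=> bT; rewrite symL dotC -(adjointP dot_norm)// -dotC symS.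
Qed.

Lemma op_a_bounded : bounded_op T -> bounded_op_on V (op_a dot S T).
Proof.
by move=> bT; exact: bounded_op_on_comp bL (adjoint_bounded dot_norm bT) bS LV.
Qed.

Lemma Ta_starE x : bounded_op T -> Ta_star x = S (T (L x)).
Proof.
move=> bT; have [VTa TaP] := adjoint_onP dot_norm x subV (op_a_bounded bT).
apply: (dot_inj (dot := dot) subV) => // y Vy.
by rewrite -TaP// op_a_dot.
Qed.

Lemma Ta_star_bounded : bounded_op T -> bounded_op_on V Ta_star.
Proof.
move=> bT; have -> : Ta_star = S \o T \o L by apply/funext => x; exact: Ta_starE.
exact: bounded_op_on_comp.
Qed.

Lemma adjoint_Ta_starE x : bounded_op T -> adjoint_on dot V Ta_star x = op_a dot S T x.
Proof.
move=> bT; have [VTa TaP] := adjoint_onP dot_norm x subV (Ta_star_bounded bT).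
apply: (dot_inj (dot := dot) subV) => [//||y Vy].
  by have [VTa' _ _] := op_a_bounded bT; exact: LV.
by rewrite -TaP// Ta_starE// dotC -op_a_dot// -dotC.
Qed.

Lemma anormE x : anorm dot (S \o S) x ^+ 2 = dot (S x) (S x).
Proof. by rewrite /anorm sqrtCK /= symS. Qed.

(** Applying [L] to [S S z = T^* S S x], the equation that defines the sharp of [T] at [x], cancels
    one [S] on the left. *)
Lemma sharpE x : closure (range (S \o S)) = V -> B_A dot (S \o S) T ->
  S (sharp dot (S \o S) T x) = op_a dot S T (S x).
Proof.
move=> VE [bT ranT]; rewrite /sharp.
have [|] := @xgetPex _ 0 [set z | (S \o S) z = adjoint dot T ((S \o S) x) /\
    closure (range (S \o S)) z].
  have [w _ wE] : range (S \o S) (adjoint dot T (S (S x))) by apply: ranT; exists x.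
  (* [w] need not lie in [V]; its projection [L (S w)] does and has the same image under [S]. *)
  by exists (L (S w)); rewrite VE -wE /= LK.
move: (xget _ _) => z /= SSz _.
by rewrite /op_a -SSz LVK.
Qed.

(** A-normality at [L y] says that [Ta_star] and [T_a] have equal norms at [y] in [V]. Polarization
    extends this to inner products, and moving the operators across [dot] turns it into
    commutation. *)
Lemma Ta_star_normal : closure (range (S \o S)) = V -> B_A dot (S \o S) T ->
  A_normal dot (S \o S) T -> normal_on dot V Ta_star.
Proof.
move=> VE BAT normT; have [bT _] := BAT.
split=> [|x Vx]; first exact: Ta_star_bounded.
rewrite !adjoint_Ta_starE//.
have bTa := Ta_star_bounded bT; have [VTa linTa _] := bTa.
have bop := op_a_bounded bT; have [Vop linop _] := bop.
have isom y : V y -> dot (Ta_star y) (Ta_star y) = dot (op_a dot S T y) (op_a dot S T y).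
  move=> Vy; have /(congr1 (fun a => a ^+ 2)) := normT (L y).
  by rewrite !anormE sharpE// LK// Ta_starE.
have isom2 y z : V y -> V z ->
    dot (Ta_star y) (Ta_star z) = dot (op_a dot S T y) (op_a dot S T z).
  move=> Vy Vz; apply/eqP; rewrite -subr_eq0; apply/eqP.
  apply: (@polarization _ _ V (fun y z => dot (Ta_star y) (Ta_star z)
    - dot (op_a dot S T y) (op_a dot S T z))) => //.
  - by move=> a u v w Vu Vv Vw; rewrite linTa// linop// !dotDl !dotZl; ring.
  - by move=> a u v w Vu Vv Vw; rewrite linTa// linop// !dotDr !dotZr; ring.
  - by move=> u /isom ->; rewrite subrr.
apply: (dot_inj (dot := dot) subV); [exact/VTa/Vop|exact/Vop/VTa|move=> y Vy].
rewrite [in LHS]Ta_starE// -op_a_dot// -isom2// [LHS]dotC [RHS]dotC op_a_dot//.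
by rewrite -Ta_starE.
Qed.

(** For [x] in [ker S], the squared norm of [S (T x)] is the pairing of [x] with a vector of
    [R(S S)], hence 0. *)
Lemma B_A_sqrtA : B_A dot (S \o S) T -> B_sqrtA dot S T.
Proof.
move=> [bT ranT]; apply/(B_sqrtAP dot_norm subV symS rangeS); split=> // x Sx.
apply: (dotxx_eq0 (dot := dot)); rewrite symS (adjointP dot_norm)//.
have [w _ /= <-] : range (S \o S) (adjoint dot T (S (S (T x)))).
  by apply: ranT; exists (T x).
by rewrite -symS Sx dot0l.
Qed.

End AReduction.

(** * The range of the square root, and the spectral mapping for the A-spectrum *)

Lemma range_sqrt (R : realType) (H : completeNormedModType (complexes R))
    (dot : {dot H for conjC}) (dot_norm : forall x : H, `|x| ^+ 2 = dot x x)
    (S : H -> H) : (forall x y, dot (S x) y = dot x (S y)) -> linear S ->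
  closed_subspace (range (S \o S)) -> range S = range (S \o S).
Proof.
move=> symS linS subA; apply/seteqP.
split=> [_ [x _ <-]|_ [x _ <-]]; last by exists (S x).
have [v Av xv] := projection_ex dot_norm (S x) subA.
(* With [y = S x - v] orthogonal to [R(S S)], symmetry gives [S S y = 0], then [S y = 0]; so [y] is
   orthogonal to both [S x] and [v]. *)
have SS0 : S (S (S x - v)) = 0.
  apply: (dotxx_eq0 (dot := dot)); rewrite !symS; apply: xv.
  by exists (S (S (S x - v))).
have S0 : S (S x - v) = 0.
  by apply: (dotxx_eq0 (dot := dot)); rewrite -symS SS0 dot0l.
suff /subr0_eq -> : S x - v = 0 by [].
apply: (dotxx_eq0 (dot := dot)); rewrite dotBl symS S0 dot0r.
by rewrite (dot_eq0C (xv _ Av)) subrr.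
Qed.

Theorem theorem4p7 (R : realType) (H : completeNormedModType (complexes R))
    (dot : {dot H for conjC}) (dot_norm : forall x : H, `|x| ^+ 2 = dot x x)
    (A : H -> H) (A_bounded : bounded_op A) (A_neq0 : exists x, A x != 0)
    (A_pos : positive_op dot A) (A_closed : closed (range A))
    (sqrtA : H -> H) (sqrtAP : positive_sqrt dot A sqrtA)
    (cfc : (H -> H) -> (complexes R -> complexes R) -> H -> H)
    (cfcP : continuous_functional_calculus dot (closure (range A)) cfc)
    (T : H -> H) (T_BA : B_A dot A T) (T_normal : A_normal dot A T)
    (f : complexes R -> complexes R)
    (f_cont : {within A_spectrum dot A sqrtA T, continuous f}) :
  let V := closure (range A) in
  let Ta_star := adjoint_on dot V (op_a dot sqrtA T) in
  f @` A_spectrum dot A sqrtA T =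
  A_spectrum dot A sqrtA (mp_inverse dot sqrtA \o cfc Ta_star f \o sqrtA).
Proof.
move=> V Ta_star; have [bS posS SSA] := sqrtAP.
have symS := positive_symmetric bS.1 posS.
have VE : V = range A by exact/esym/closure_id.
have subA : closed_subspace (range A).
  split=> // [|a _ _ [x _ <-] [y _ <-]]; last first.
    by exists (a *: x + y); rewrite ?A_bounded.1.
  by exists 0 => //; have := linear_opB A_bounded.1 0 0; rewrite !subrr.
have subV : closed_subspace V by rewrite VE.
have V_neq0 : exists2 v, V v & v != 0.
  by rewrite VE; have [x Ax] := A_neq0; exists (A x) => //; exists x.
have rangeS : range sqrtA = V.
  by rewrite VE -SSA; apply: range_sqrt => //; rewrite ?SSA//; exact: bS.1.
have bT : bounded_op T by case: T_BA.
have VSS : closure (range (sqrtA \o sqrtA)) = V by rewrite SSA.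
have normTa : normal_on dot V Ta_star by apply: Ta_star_normal; rewrite ?SSA.
have fc := cfcP _ normTa.
have BT : B_sqrtA dot sqrtA T by apply: (B_A_sqrtA dot_norm subV); rewrite ?SSA.
(* Continuity of [f] is given on the A-spectrum; this equality carries it to the spectrum of
   [Ta_star], where the functional calculus requires it. *)
have sigmaT : A_spectrum dot A sqrtA T = spectrum_on V Ta_star.
  rewrite -SSA (A_spectrumE dot_norm subV)//; apply: spectrum_on_ext => x Vx.
  by rewrite /Ta_star Ta_starE.
rewrite sigmaT in f_cont *.
rewrite -SSA (A_spectrum_lift dot_norm subV)//; last exact: fc_bounded fc _ f_cont.
by rewrite (spectrum_on_fc fc f_cont).
Qed.
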